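(* Let $(\mathcal E,\langle,\rangle_{\mathcal E})$ be an embedded ambient space of a manifold $\mathcal M$. Let $\mathsf g$ be a smooth operator-valued function associating to each $Y\in\mathcal M$ a self-adjoint positive-definite operator $\mathsf g(Y)$ on $\mathcal E$, so that $\mathsf g$ induces a Riemannian metric on $\mathcal M$ by $\langle\xi,\eta\rangle_R=\langle\xi,\mathsf g(Y)\eta\rangle_{\mathcal E}$ on each $T_Y\mathcal M\subset\mathcal E$. Let $\mathcal H$ be a subbundle of $T\mathcal M$ and let $\Pi_{\mathcal H,\mathsf g}$ be the operator-valued function such that $\Pi_{\mathcal H,\mathsf g}(Y)$ is the projection associated with $\mathsf g(Y)$ from $\mathcal E$ to the fiber $\mathcal H_Y$. For an ambient gradient $\mathsf{grad}\hat f$ of a function $f$ on $\mathcal M$, the $\mathcal H$-Riemannian gradient of $f$ is $$\mathsf{rgrad}_{\mathcal H,f}=\Pi_{\mathcal H,\mathsf g}\,\mathsf g^{-1}\,\mathsf{grad}\hat f.$$ If there are an inner product space $\mathcal E_{\mathrm J}$ and a map $\mathrm J$ from $\mathcal M$ to the space of linear maps from $\mathcal E$ to $\mathcal E_{\mathrm J}$ such that for each $Y\in\mathcal M$ the range of $\mathrm J(Y)$ is precisely $\mathcal E_{\mathrm J}$ and its nullspace is $\mathcal H_Y$, then for $e\in\mathcal E$ $$\Pi_{\mathcal H,\mathsf g}(Y)e=e-\mathsf g^{-1}\mathrm J^{\mathfrak t}(\mathrm J\mathsf g^{-1}\mathrm J^{\mathfrak t})^{-1}\mathrm Je,\qquad\text{all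 evaluated at }Y.$$ If there are an inner product space $\mathcal E_{\mathrm N}$ and a map $\mathrm N$ from $\mathcal M$ to the space of linear maps from $\mathcal E_{\mathrm N}$ to $\mathcal E$ such that for each $Y\in\mathcal M$, $\mathrm N(Y)$ is one-to-one with range precisely $\mathcal H_Y$, then for $e\in\mathcal E$ $$\Pi_{\mathcal H,\mathsf g}(Y)e=\mathrm N(\mathrm N^{\mathfrak t}\mathsf g\mathrm N)^{-1}\mathrm N^{\mathfrak t}\mathsf ge,\qquad\text{all evaluated at }Y.$$
   Context: An embedded ambient space of a manifold $\mathcal M$ is a finite-dimensional real inner product space $(\mathcal E,\langle,\rangle_{\mathcal E})$ together with a differentiable (not necessarily isometric) embedding $\mathcal M\subset\mathcal E$; tangent spaces of $\mathcal M$ are viewed as subspaces of $\mathcal E$. $A^{\mathfrak t}$ denotes the adjoint of a linear map $A$ between inner product spaces (with respect to the inner products $\langle,\rangle_{\mathcal E}$, $\langle,\rangle_{\mathcal E_{\mathrm J}}$, $\langle,\rangle_{\mathcal E_{\mathrm N}}$). The projection associated with $\mathsf g(Y)$ onto $\mathcal H_Y$ is the linear map $\Pi:\mathcal E\to\mathcal H_Y$ with $\langle\Pi v,\mathsf g(Y)w\rangle_{\mathcal E}=\langle v,\mathsf g(Y)w\rangle_{\mathcal E}$ for all $v\in\mathcal E,w\in\mathcal H_Y$. An ambient gradient of $f$ is a function $\mathsf{grad}\hat f:\mathcal M\to\mathcal E$ such that $\langle\eta,\mathsf{grad}\hat f\rangle_{\mathcal E}=\mathrm D_\eta f$ for all vector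 fields $\eta$ on $\mathcal M$ ($\mathrm D_\eta f$ is the derivative of $f$ along $\eta$). The $\mathcal H$-Riemannian gradient $\mathsf{rgrad}_{\mathcal H,f}$ is the unique $\mathcal H$-valued vector field with $\langle\mathsf{rgrad}_{\mathcal H,f},\xi_{\mathcal H}\rangle_R=\mathrm D_{\xi_{\mathcal H}}f$ for every $\mathcal H$-valued vector field $\xi_{\mathcal H}$. *)

(* Defs.v *)
From HB Require Import structures.
From mathcomp Require Import all_boot all_order all_algebra sesquilinear.
From mathcomp Require Import all_classical all_reals all_analysis.

Set Implicit Arguments.
Unset Strict Implicit.
Unset Printing Implicit Defensive.

Import Order.TTheory GRing.Theory Num.Theory.
Import numFieldNormedType.Exports.

Local Open Scope classical_set_scope.
Local Open Scope ring_scope.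

(* Finite-dimensional real inner product spaces, normed by the inner product. *)
HB.mixin Record isInnerProductSpace (R : realType) E
    of NormedModule R E & Vector R E := {
  inner : {dot E for idfun} ;
  norm_inner : forall x : E, `|x| = Num.sqrt (inner x x)
}.

#[short(type="innerProductType")]
HB.structure Definition InnerProductSpace (R : realType) :=
  { E of NormedModule R E & Vector R E & isInnerProductSpace R E }.

Notation "'[ u , v ]" := (inner u v) : ring_scope.

Section InnerProduct.
Context {R : realType}.
Implicit Types E F : innerProductType R.

Lemma innerC E (u v : E) : '[u, v] = '[v, u].
Proof. by rewrite hermC /= expr0 mul1r. Qed.

Lemma inner_gt0 E (u : E) : u != 0 -> 0 < '[u, u].
Proof. exact: (@neq0_dnorm_gt0 _ _ _ (inner : {dot E for idfun})). Qed.

Lemma innerBl E (u v w : E) : '[u - v, w] = '[u, w] - '[v, w].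
Proof. exact: linearBl. Qed.

Lemma innerPl E a (u v w : E) : '[a *: u + v, w] = a * '[u, w] + '[v, w].
Proof. exact: linearPl. Qed.

Definition is_adjoint E F (A : 'Hom(E, F)) (B : 'Hom(F, E)) :=
  forall x y, '[A x, y] = '[x, B y].

Definition adjoint E F (A : 'Hom(E, F)) : 'Hom(F, E) :=
  xget 0 [set B | is_adjoint A B].

Lemma inner_inj E (u v : E) : (forall w, '[u, w] = '[v, w]) -> u = v.
Proof.
move=> uv; apply/eqP; rewrite -subr_eq0; apply: contraT => /inner_gt0.
by rewrite innerBl uv subrr ltxx.
Qed.

(* Riesz representation *)
Lemma inner_surj E (phi : 'Hom(E, R^o)) : exists u : E, forall w, phi w = '[w, u].
Proof.
pose D u : 'Hom(E, R^o) := linfun (inner u : E -> R^o).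
have DE u w : D u w = '[u, w] by rewrite lfunE.
have Dlin : linear D.
  move=> a u v; apply/lfunP => w; rewrite add_lfunE scale_lfunE !DE.
  by rewrite innerPl.
pose DL : {linear E -> 'Hom(E, R^o)} :=
  HB.pack D (GRing.isLinear.Build _ _ _ _ D Dlin).
have kD : lker (linfun DL) == 0%VS.
  apply/lker0P => u v; rewrite !lfunE /= => Duv.
  by apply: inner_inj => w; rewrite -!DE Duv.
have : limg (linfun DL) = fullv.
  apply/eqP; rewrite eqEdim subvf /= (limg_dim_eq (f := linfun DL)); last first.
    by rewrite (eqP kD) capv0.
  by rewrite !dimvf /dim /= muln1.
move/vspaceP/(_ phi); rewrite memvf => /memv_imgP[u _ ->].
by exists u => w; rewrite innerC -DE lfunE.
Qed.

Lemma adjoint_ex E F (A : 'Hom(E, F)) : exists B, is_adjoint A B.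
Proof.
have /choice[B BP] (y : F) : exists u : E, forall x, '[A x, y] = '[x, u].
  have [u uP] := inner_surj (linfun (inner y : F -> R^o) \o A)%VF.
  by exists u => x; rewrite -uP comp_lfunE lfunE innerC.
have Blin : linear B.
  move=> a u v; apply: inner_inj => w; rewrite innerPl !(innerC _ w) -!BP.
  by rewrite !(innerC (A w)) innerPl.
pose BL : {linear F -> E} := HB.pack B (GRing.isLinear.Build _ _ _ _ B Blin).
by exists (linfun BL) => x y; rewrite lfunE BP.
Qed.

Lemma adjointP E F (A : 'Hom(E, F)) x y : '[A x, y] = '[x, adjoint A y].
Proof.
have [B AB] := adjoint_ex A.
exact: (@xgetPex _ 0 [set B | is_adjoint A B] (ex_intro _ B AB)).
Qed.

End InnerProduct.

Section Smooth.
Context {R : realType} {V W : normedModType R}.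

Fixpoint Ck (k : nat) (U : set V) (f : V -> W) : Prop :=
  if k is k'.+1 then
    (forall x, U x -> differentiable f x) /\
    (forall v, Ck k' U (fun x => 'D_v f x))
  else forall x, U x -> {for x, continuous f}.

Definition smooth_open (U : set V) (f : V -> W) := forall k, Ck k U f.

(* On an arbitrary subset S, smooth means locally the restriction of a smooth
   function on an open set; only the values of f on S matter. *)
Definition smooth_on (S : set V) (f : V -> W) :=
  forall p, S p -> exists (U : set V) (F : V -> W),
    [/\ open U, U p, smooth_open U F & forall x, S x -> U x -> F x = f x].

End Smooth.

Section EmbeddedManifold.
Context {R : realType} {E : innerProductType R}.
Implicit Types (M : set E) (H : E -> {vspace E}) (f : E -> R).
Implicit Types (X grad : E -> E) (g : E -> 'End(E)).

(* M is a smooth d-dimensional embedded submanifold: (Phi, Psi) is a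
   diffeomorphism between the open sets U and V straightening M. *)
Definition embedded_submanifold (d : nat) M :=
  forall p, M p -> exists (U V : set E) (Phi Psi : E -> E) (L : {vspace E}),
    [/\ [/\ open U, open V & U p],
        smooth_open U Phi /\ smooth_open V Psi,
        (forall x, U x -> V (Phi x) /\ Psi (Phi x) = x),
        (forall y, V y -> U (Psi y) /\ Phi (Psi y) = y) &
        \dim L = d /\ forall x, U x -> (M x <-> Phi x \in L)].

Definition curve_at M (p v : E) (c : R -> E) :=
  [/\ c 0 = p, \forall t \near 0, M (c t),
      exists2 I : set R, open I /\ I 0 & smooth_open I c &
      is_derive (0 : R) 1 c v].

Definition tangent M (p : E) : set E := [set v | exists c, curve_at M p v c].

(* D_v f (p) = l, for v tangent to M at p and f defined on M only: hence the
   curves rather than the directional derivative of the ambient space. *)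
Definition derivative_along M f (p v : E) (l : R) :=
  forall c, curve_at M p v c -> is_derive (0 : R) 1 (f \o c) l.

Definition vector_field M X :=
  smooth_on M X /\ forall p, M p -> tangent M p (X p).

(* A smooth subbundle of TM of rank k, given by its fibers. *)
Definition subbundle (k : nat) M H :=
  (forall p, M p -> [set` H p] `<=` tangent M p) /\
  (forall p, M p -> exists (U : set E) (n : 'I_k -> E -> E),
    [/\ open U, U p, forall i, smooth_on (M `&` U) (n i) &
        forall q, M q -> U q -> basis_of (H q) [tuple n i q | i < k]]).

Definition subbundle_field M H X :=
  vector_field M X /\ forall p, M p -> X p \in H p.

(* Smoothness of the operator-valued g is that of all Y |-> g Y v, i.e. of the
   matrix entries. *)
Definition metric_operator M g :=
  (forall v, smooth_on M (fun Y => g Y v)) /\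
  (forall Y, M Y -> adjoint (g Y) = g Y /\
     forall v, v != 0 -> 0 < '[v, g Y v]).

Definition rmetric g (Y u v : E) : R := '[u, g Y v].

Definition is_gprojection (G : 'End(E)) (K : {vspace E}) (P : 'End(E)) :=
  (forall v, P v \in K) /\
  (forall v w, w \in K -> '[P v, G w] = '[v, G w]).

Definition ambient_gradient M f grad :=
  forall eta, vector_field M eta ->
  forall Y, M Y -> derivative_along M f Y (eta Y) '[eta Y, grad Y].

Definition represents_differential M g H f X :=
  forall xi, subbundle_field M H xi ->
  forall Y, M Y -> derivative_along M f Y (xi Y) (rmetric g Y (X Y) (xi Y)).

(* Vector fields are only considered on M, hence uniqueness on M only. *)
Definition is_rgradient M g H f X :=
  [/\ subbundle_field M H X, represents_differential M g H f X &
      forall X', subbundle_field M H X' -> represents_differential M g H f X' ->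
      forall Y, M Y -> X' Y = X Y].

Lemma rmetric_sym M g Y u v : metric_operator M g -> M Y ->
  rmetric g Y u v = rmetric g Y v u.
Proof.
by move=> [_ gP] /gP[gA _]; rewrite /rmetric innerC adjointP gA.
Qed.

Lemma rmetric_gt0 M g Y u : metric_operator M g -> M Y -> u != 0 ->
  0 < rmetric g Y u u.
Proof. by move=> [_ gP] /gP[_]; apply. Qed.

End EmbeddedManifold.

(* Main.v *)
(* Everything but the smoothness of the gradient is linear algebra on a single
   tangent space: Pi v is determined by Pi v \in H and
   <Pi v, g w> = <v, g w> for w in H.

   For smoothness, let n_1, ..., n_k be a local frame of H. A section X of H has
   coordinates obtained by inverting the Gram matrix (<n_i, g n_j>), so by
   Cramer's rule X is smooth as soon as the <X, g n_i> are. First take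
   X = Pi v for a fixed v in E, where <X, g n_i> = <v, g n_i>: this is a global
   smooth field, equal to v at any point where v is in the fiber, so no bump
   function is needed to test the ambient gradient in every direction of H.
   Then take X = Pi g^-1 grad f, where <X, g n_i> = <n_i, grad f> is the
   derivative along n_i of a smooth local extension of f. *)
Require Import Defs.
From HB Require Import structures.
From mathcomp Require Import all_boot all_order all_algebra sesquilinear.
From mathcomp Require Import all_classical all_reals all_analysis.
From mathcomp Require Import ring.

Set Implicit Arguments.
Unset Strict Implicit.
Unset Printing Implicit Defensive.

Import Order.TTheory GRing.Theory Num.Theory.
Import numFieldNormedType.Exports.

Local Open Scope classical_set_scope.
Local Open Scope ring_scope.

(** * Calculus of [Ck] maps on open sets *)

Section SmoothCalculus.
Context {R : realType} {V : normedModType R}.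

(** Only values near [x] enter the first-order expansion, so that of [f] is also one for [g], and
    uniqueness of the differential identifies its linear part. *)
Lemma near_eq_differentiable (W : normedModType R) (f g : V -> W) x :
  (\near x, f x = g x) -> differentiable f x -> differentiable g x.
Proof.
move=> fg; have fgx := nbhs_singleton fg.
move=> /diff_locallyP[df fE].
have gE : g \o shift x = cst (g x) + 'd f x +o_ 0 id.
  have fg0 : \forall y \near 0, f (y + x) = g (y + x).
    by move: fg; rewrite (near_shift 0) subr0.
  apply/eqaddoP => e e0; move/eqaddoP/(_ e e0) : fE; apply: filterS2 fg0 => y.
  by rewrite /= !fctE /= => ->; rewrite -fgx.
by apply/diff_locallyP; rewrite (diff_unique df gE); split.
Qed.

Lemma CkS (W : normedModType R) k (U : set V) (f : V -> W) :
  Ck k.+1 U f -> Ck k U f.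
Proof.
elim: k f => [|k IH] f [df Df].
  by move=> x /df /differentiable_continuous.
by split=> // v; apply: IH.
Qed.

Lemma Ck_sub (W : normedModType R) k (U U' : set V) (f : V -> W) :
  U' `<=` U -> Ck k U f -> Ck k U' f.
Proof.
move=> UU'; elim: k f => [|k IH] f; first by move=> h x Ux; exact: h (UU' x Ux).
by move=> [df Df]; split=> [x Ux|v]; [exact: df (UU' x Ux) | exact: IH (Df v)].
Qed.

Lemma Ck_cst (W : normedModType R) k (U : set V) (w : W) : Ck k U (fun=> w).
Proof.
elim: k w => [|k IH] w; first by move=> x _; exact: cvg_cst.
split=> [x _ | v]; first exact: differentiable_cst.
have -> : 'D_v (fun=> w) = fun=> 0 by apply/funext => x; exact: derive_cst.
exact: IH.
Qed.

(** Since [U] is open, agreement on [U] is agreement near each of its points, so the directional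
    derivatives agree on [U] as well and the induction goes through. *)
Lemma Ck_eq (W : normedModType R) k (U : set V) (f g : V -> W) :
  open U -> (forall x, U x -> f x = g x) -> Ck k U f -> Ck k U g.
Proof.
move=> oU; elim: k f g => [|k IH] f g fg.
  move=> fc x Ux; have fgx : \near x, f x = g x.
    by apply: filterS (open_nbhs_nbhs (conj oU Ux)) => y; exact: fg.
  rewrite /prop_for /continuous_at -(fg x Ux).
  by apply: cvg_trans (fc x Ux); exact: near_eq_cvg.
have fgx x : U x -> \near x, f x = g x.
  by move=> Ux; apply: filterS (open_nbhs_nbhs (conj oU Ux)) => y; exact: fg.
move=> [df Df]; split=> [x Ux | v].
  by apply: near_eq_differentiable (df x Ux); exact: fgx.
by apply: IH (Df v) => x Ux; apply: near_eq_derive; exact: fgx.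
Qed.

Lemma CkD (W : normedModType R) k (U : set V) (f g : V -> W) : open U ->
  Ck k U f -> Ck k U g -> Ck k U (fun x => f x + g x).
Proof.
move=> oU; elim: k f g => [|k IH] f g.
  by move=> fc gc x Ux; exact: continuousD (fc x Ux) (gc x Ux).
move=> [df Df] [dg Dg]; split=> [x Ux | v].
  exact: differentiableD (df x Ux) (dg x Ux).
apply: Ck_eq (IH _ _ (Df v) (Dg v)) => // x Ux.
by rewrite -deriveD //; apply: diff_derivable; [exact: df | exact: dg].
Qed.

(** Leibniz rule: the derivative along [v] is [B f ('D_v g) + B ('D_v f) g], and both terms fall
    under the induction hypothesis once the underived factor is lowered by [CkS]. *)
Lemma Ck_bilin (W1 W2 W3 : normedModType R)
    (B : {bilinear W1 -> W2 -> W3}) k (U : set V) (f : V -> W1) (g : V -> W2) :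
  continuous (fun q => B q.1 q.2) -> open U ->
  Ck k U f -> Ck k U g -> Ck k U (fun x => B (f x) (g x)).
Proof.
move=> cB oU; elim: k f g => [|k IH] f g.
  move=> fc gc x Ux.
  have fgc : {for x, continuous (fun y => (f y, g y))}.
    by apply: cvg_pair; [exact: fc | exact: gc].
  exact: continuous_comp fgc (cB _).
move=> Cf Cg; have [df Df] := Cf; have [dg Dg] := Cg.
have dp x : U x -> differentiable (fun y => (f y, g y)) x.
  by move=> Ux; apply: differentiable_pair; [exact: df | exact: dg].
have dB q := @differentiable_bilin _ _ _ _ B q cB.
have dfg x Ux := differentiable_comp (dp x Ux) (dB _).
split=> [x Ux | v]; first exact: dfg.
have CD := CkD oU (IH _ _ (CkS Cf) (Dg v)) (IH _ _ (Df v) (CkS Cg)).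
apply: Ck_eq CD => // x Ux.
rewrite [RHS](deriveE _ (dfg x Ux)) (diff_comp (dp x Ux) (dB _)) /=.
rewrite (diff_bilin _ cB) (diff_pair (df x Ux) (dg x Ux)) /=.
by rewrite (deriveE _ (df x Ux)) (deriveE _ (dg x Ux)).
Qed.

Lemma CkZ (W : normedModType R) k (U : set V) (f : V -> R) (g : V -> W) :
  open U -> Ck k U f -> Ck k U g -> Ck k U (fun x => f x *: g x).
Proof.
have scale_bilin : bilinear_for (GRing.Scale.Law.clone _ _ *:%R _)
    (GRing.Scale.Law.clone _ _ *:%R _) (fun (a : R) (w : W) => a *: w).
  split=> [w|a] b x y /=; first by rewrite scalerDl scalerA.
  by rewrite scalerDr !scalerA mulrC.
pose B : {bilinear R -> W -> W} := HB.pack (fun (a : R) (w : W) => a *: w)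
  (bilinear_isBilinear.Build _ _ _ _ _ _ _ scale_bilin).
exact/(@Ck_bilin _ _ _ B)/scale_continuous.
Qed.

Lemma CkM k (U : set V) (f g : V -> R) : open U ->
  Ck k U f -> Ck k U g -> Ck k U (fun x => f x * g x).
Proof. exact: CkZ. Qed.

Lemma CkV k (U : set V) (f : V -> R) : open U -> (forall x, U x -> f x != 0) ->
  Ck k U f -> Ck k U (fun x => (f x)^-1).
Proof.
move=> oU f0; elim: k => [|k IH].
  by move=> fc x Ux; apply: continuousV; [exact: f0 | exact: fc].
move=> Cf; have [df Df] := Cf; split=> [x Ux | v].
  by apply: differentiableV; [exact: df | exact: f0].
have CV := IH (CkS Cf).
(* This product is the derivative of the inverse, minus [f^-1] squared times ['D_v f]. *)
have CDV := CkM oU (CkM oU (Ck_cst k U (-1 : R)) (CkM oU CV CV)) (Df v).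
apply: Ck_eq CDV => // x Ux.
rewrite deriveV ?f0 //; last by apply: diff_derivable; exact: df.
by rewrite mulN1r -exprVn.
Qed.

Lemma Ck_lin (W W' : normedModType R) (L : {linear W -> W'}) k (U : set V)
    (f : V -> W) :
  continuous L -> open U -> Ck k U f -> Ck k U (fun x => L (f x)).
Proof.
move=> cL oU; elim: k f => [|k IH] f.
  by move=> fc x Ux; apply: continuous_comp; [exact: fc | exact: cL].
move=> [df Df]; split=> [x Ux | v].
  by apply: differentiable_comp; [exact: df | exact: linear_differentiable].
apply: Ck_eq (IH _ (Df v)) => // x Ux.
have dL := linear_differentiable (f x) cL.
have dLf := differentiable_comp (df x Ux) dL.
rewrite -[RHS]/('D_v (L \o f) x) (deriveE _ dLf) (diff_comp (df x Ux) dL) /=.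
by rewrite (diff_lin _ cL) (deriveE _ (df x Ux)).
Qed.

End SmoothCalculus.

(** * Smoothness at a point, relative to an arbitrary subset *)

Section SmoothAt.
Context {R : realType} {V : normedModType R} (S : set V) (p : V).

(** The condition that [smooth_on] imposes at each point of [S], isolated so that closure properties
    can be proved one point at a time. *)
Definition smooth_at (W : normedModType R) (f : V -> W) :=
  exists (U : set V) (F : V -> W),
    [/\ open U, U p, smooth_open U F & forall x, S x -> U x -> F x = f x].

Lemma smooth_at_lift (W1 W2 W3 : normedModType R) (op : W1 -> W2 -> W3)
    (f : V -> W1) (h : V -> W2) :
  (forall (U : set V) F G, open U -> smooth_open U F -> smooth_open U G ->
    smooth_open U (fun x => op (F x) (G x))) ->
  smooth_at f -> smooth_at h -> smooth_at (fun x => op (f x) (h x)).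
Proof.
move=> opP [U [F [oU Up CF Ff]]] [U' [G [oU' U'p CG Gh]]].
exists (U `&` U'), (fun x => op (F x) (G x)); split=> //.
- exact: openI.
- apply: opP; first exact: openI.
  + by move=> k; apply: Ck_sub (CF k); exact: subIsetl.
  + by move=> k; apply: Ck_sub (CG k); exact: subIsetr.
- by move=> x Sx [Ux U'x]; rewrite Ff ?Gh.
Qed.

Lemma smooth_at_eq (W : normedModType R) (U : set V) (f h : V -> W) :
  open U -> U p -> (forall x, S x -> U x -> f x = h x) ->
  smooth_at f -> smooth_at h.
Proof.
move=> oU Up fh [U' [F [oU' U'p CF Ff]]].
exists (U `&` U'), F; split=> //.
- exact: openI.
- by move=> k; apply: Ck_sub (CF k); exact: subIsetr.
- by move=> x Sx [Ux U'x]; rewrite Ff ?fh.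
Qed.

Lemma eq_smooth_at (W : normedModType R) (f h : V -> W) :
  smooth_at f -> f =1 h -> smooth_at h.
Proof. by move=> + /funext <-. Qed.

Lemma smooth_at_cst (W : normedModType R) (w : W) : smooth_at (fun=> w).
Proof.
exists setT, (fun=> w); split=> //; first exact: openT.
by move=> k; exact: Ck_cst.
Qed.

Lemma smooth_atD (W : normedModType R) (f h : V -> W) :
  smooth_at f -> smooth_at h -> smooth_at (fun x => f x + h x).
Proof.
apply: smooth_at_lift => U F G oU CF CG k.
exact: CkD oU (CF k) (CG k).
Qed.

Lemma smooth_atZ (W : normedModType R) (f : V -> R) (h : V -> W) :
  smooth_at f -> smooth_at h -> smooth_at (fun x => f x *: h x).
Proof.
apply: smooth_at_lift => U F G oU CF CG k.
exact: CkZ oU (CF k) (CG k).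
Qed.

Lemma smooth_atM (f h : V -> R) :
  smooth_at f -> smooth_at h -> smooth_at (fun x => f x * h x).
Proof. exact: smooth_atZ. Qed.

Lemma smooth_at_lin (W W' : normedModType R) (L : {linear W -> W'})
  (f : V -> W) : continuous L -> smooth_at f -> smooth_at (fun x => L (f x)).
Proof.
move=> cL [U [F [oU Up CF Ff]]]; exists U, (fun x => L (F x)); split=> //.
  by move=> k; exact: Ck_lin.
by move=> x Sx Ux; rewrite Ff.
Qed.

Lemma smooth_atV (f : V -> R) : S p -> f p != 0 ->
  smooth_at f -> smooth_at (fun x => (f x)^-1).
Proof.
move=> Sp fp0 [U [F [oU Up CF Ff]]].
have Fp0 : F p != 0 by rewrite Ff.
(* The extension [F] may vanish away from [p], so its domain is cut down to where it does not; this
   set is open because [F] is continuous on [U]. *)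
exists (U `&` F @^-1` [set t | t != 0]), (fun x => (F x)^-1).
have oUF : open (U `&` F @^-1` [set t | t != 0]).
  rewrite openE => x [Ux Fx0]; apply: filterI; first exact: open_nbhs_nbhs.
  apply: (CF 0%N x Ux); apply: open_nbhs_nbhs; split=> //; exact: open_neq.
split=> //.
  move=> k; apply: CkV => [//|x [] //|].
  by apply: Ck_sub (CF k); exact: subIsetl.
by move=> x Sx [Ux _]; rewrite Ff.
Qed.

Lemma smooth_at_sum (W : normedModType R) (I : Type) (r : seq I) (P : pred I)
    (f : I -> V -> W) : (forall i, P i -> smooth_at (f i)) ->
  smooth_at (fun x => \sum_(i <- r | P i) f i x).
Proof.
move=> fP; elim: r => [|i r IH].
  by apply: (eq_smooth_at (smooth_at_cst (0 : W))) => x; rewrite big_nil.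
have [Pi|nPi] := boolP (P i).
  by apply: (eq_smooth_at (smooth_atD (fP i Pi) IH)) => x; rewrite big_cons Pi.
by apply: (eq_smooth_at IH) => x; rewrite big_cons (negPf nPi).
Qed.

Lemma smooth_at_prod (I : Type) (r : seq I) (f : I -> V -> R) :
  (forall i, smooth_at (f i)) -> smooth_at (fun x => \prod_(i <- r) f i x).
Proof.
move=> fP; elim: r => [|i r IH].
  by apply: (eq_smooth_at (smooth_at_cst (1 : R))) => x; rewrite big_nil.
by apply: (eq_smooth_at (smooth_atM (fP i) IH)) => x; rewrite big_cons.
Qed.

Lemma smooth_at_det n (A : V -> 'M[R]_n) :
  (forall i j, smooth_at (fun x => A x i j)) -> smooth_at (fun x => \det (A x)).
Proof.
move=> AP; apply: smooth_at_sum => s _; apply: smooth_atM.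
  exact: smooth_at_cst.
exact: smooth_at_prod.
Qed.

(** Cramer's rule: each entry is a cofactor divided by the determinant, and a cofactor is a sign
    times the determinant of a submatrix. *)
Lemma smooth_at_invmx n (A : V -> 'M[R]_n) :
  S p -> (forall x, S x -> A x \in unitmx) ->
  (forall i j, smooth_at (fun x => A x i j)) ->
  forall i j, smooth_at (fun x => invmx (A x) i j).
Proof.
move=> Sp uA AP i j.
apply: (@smooth_at_eq _ setT (fun x => (\det (A x))^-1 * cofactor (A x) j i)).
- exact: openT.
- by [].
- by move=> x Sx _; rewrite /invmx uA // !mxE.
apply: smooth_atM.
  apply: smooth_atV => //; last exact: smooth_at_det.
  by rewrite -unitfE -unitmxE uA.
apply: smooth_atM; first exact: smooth_at_cst.
apply: smooth_at_det => i' j'.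
by apply: (eq_smooth_at (AP _ _)) => x; rewrite !mxE.
Qed.

End SmoothAt.

(** * Smoothness of inner products and of operators applied to vector fields *)

Section InnerProductSmooth.
Context {R : realType} {E : innerProductType R}.

Lemma normr_sqr_inner (v : E) : `|v| ^+ 2 = '[v, v].
Proof.
rewrite norm_inner sqr_sqrtr //; have [->|/inner_gt0/ltW//] := eqVneq v 0.
by rewrite linear0l.
Qed.

Lemma innerDl (u v w : E) : '[u + v, w] = '[u, w] + '[v, w].
Proof. exact: linearDl. Qed.

Lemma innerZl a (u w : E) : '[a *: u, w] = a * '[u, w].
Proof. exact: linearZl_LR. Qed.

Lemma inner_suml I (r : seq I) (P : pred I) (u : I -> E) (w : E) :
  '[\sum_(i <- r | P i) u i, w] = \sum_(i <- r | P i) '[u i, w].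
Proof. exact: linear_sumlz. Qed.

(** Polarization expresses the inner product through norms, which are continuous. *)
Lemma inner_continuous (u : E) : continuous (fun v : E => '[v, u]).
Proof.
rewrite (_ : (fun v : E => '[v, u]) = fun v =>
    (`|v + u| ^+ 2 - `|v| ^+ 2 - `|u| ^+ 2) / 2); last first.
  apply/funext => v; rewrite !normr_sqr_inner innerDl.
  rewrite ![in RHS](innerC _ (v + u)) !innerDl (innerC u v).
  by apply: (canRL (mulfK _)) => //; ring.
move=> v; have cn : `|w| @[w --> v] --> `|v| by exact: norm_continuous.
have cs : `|w + u| @[w --> v] --> `|v + u|.
  by apply: cvg_norm; apply: cvgD; [exact: cvg_id | exact: cvg_cst].
apply: cvgM; last exact: cvg_cst.
apply: cvgB; last exact: cvg_cst.
by apply: cvgB; apply: cvgM.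
Qed.

(** Here [e] is a basis and [u] lists the Riesz representatives of its coordinate functionals. *)
Lemma dual_basis :
  exists n (e u : 'I_n -> E), forall v, v = \sum_j '[v, u j] *: e j.
Proof.
pose b := vbasis {:E}.
have /choice[u uP] (j : 'I_(\dim {:E})) :
    exists u : E, forall v, coord b j v = '[v, u].
  have [u uP] := inner_surj (linfun (coord b j : E -> R^o)).
  by exists u => v; rewrite -uP lfunE.
exists (\dim {:E}), (fun j => b`_j), u => v.
rewrite {1}(coord_vbasis (memvf v)); apply: eq_bigr => j _.
by rewrite uP.
Qed.

Context {V : normedModType R} (S : set V) (p : V).

Lemma smooth_at_innerl (X : V -> E) (u : E) :
  smooth_at S p X -> smooth_at S p (fun x => '[X x, u]).
Proof.
have lin : linear (fun v : E => '[v, u]) by move=> a v w; rewrite innerPl.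
pose L : {linear E -> R} := HB.pack (fun v : E => '[v, u])
  (GRing.isLinear.Build _ _ _ _ _ lin).
by apply: (@smooth_at_lin _ _ _ _ _ _ L); exact: inner_continuous.
Qed.

(** Expanding [X x] in a fixed basis leaves only the values of [h x] at constant vectors, with
    smooth coefficients. Linearity is asked only near [p] so that [h x v] can be a derivative
    ['D_v F x], which is linear in [v] where [F] is differentiable. *)
Lemma smooth_at_apply (W : normedModType R) (h : V -> E -> W) (X : V -> E) :
  (exists U : set V, [/\ open U, U p & forall x, S x -> U x -> linear (h x)]) ->
  (forall v, smooth_at S p (fun x => h x v)) -> smooth_at S p X ->
  smooth_at S p (fun x => h x (X x)).
Proof.
move=> [U [oU Up hlin]] hS XS; have [n [e [u euE]]] := dual_basis.
apply: (@smooth_at_eq _ _ _ _ _ U (fun x => \sum_j '[X x, u j] *: h x (e j))).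
- by [].
- by [].
- move=> x Sx Ux.
  pose L : {linear E -> W} := HB.pack (h x)
    (GRing.isLinear.Build _ _ _ _ _ (hlin x Sx Ux)).
  rewrite {2}(euE (X x)) -[RHS]/(L _) linear_sum.
  by apply: eq_bigr => j _; rewrite linearZ.
- apply: smooth_at_sum => j _; apply: smooth_atZ => //.
  exact: smooth_at_innerl.
Qed.

Lemma smooth_at_inner (X Y : V -> E) :
  smooth_at S p X -> smooth_at S p Y -> smooth_at S p (fun x => '[X x, Y x]).
Proof.
move=> XS YS; apply: (smooth_at_apply (h := fun x v => '[X x, v])) => //.
  exists setT; split=> //; first exact: openT.
  by move=> x _ _ a v w; rewrite innerC innerPl !(innerC _ (X x)).
by move=> v; exact: smooth_at_innerl.
Qed.

Lemma smooth_at_lfun (A : V -> 'End(E)) (X : V -> E) :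
  (forall v, smooth_at S p (fun x => A x v)) -> smooth_at S p X ->
  smooth_at S p (fun x => A x (X x)).
Proof.
apply: smooth_at_apply; exists setT; split=> //; first exact: openT.
by move=> x _ _ a v w; rewrite linearP.
Qed.

End InnerProductSmooth.

(** * Locality of smoothness in the subset *)

Section SmoothAtRestriction.
Context {R : realType} {V W : normedModType R}.
Implicit Types (S U : set V) (f : V -> W).

Lemma smooth_at_sub S S' p f : S' `<=` S -> smooth_at S p f -> smooth_at S' p f.
Proof.
move=> S'S [U [F [oU Up CF Ff]]]; exists U, F; split=> // x /S'S; exact: Ff.
Qed.

Lemma smooth_at_setI S U p f :
  open U -> U p -> smooth_at (S `&` U) p f -> smooth_at S p f.
Proof.
move=> oU Up [U' [F [oU' U'p CF Ff]]]; exists (U `&` U'), F; split=> //.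
- exact: openI.
- by move=> k; apply: Ck_sub (CF k); exact: subIsetr.
- by move=> x Sx [Ux U'x]; apply: Ff.
Qed.

End SmoothAtRestriction.

(** * Derivatives along curves, Gram matrices and local frames *)

Section GradientSmoothness.
Context {R : realType} {E : innerProductType R}.
Implicit Types (M U : set E) (H : E -> {vspace E}) (g Pi : E -> 'End(E)).
Implicit Types (f : E -> R) (X : E -> E).

(** Near time 0 the curve stays in [M] and, by continuity, in [U], so [f \o c] agrees there with
    [F \o c], to which the chain rule applies. *)
Lemma curve_derive M f U (F : E -> R) p v c :
  open U -> U p -> smooth_open U F -> (forall x, M x -> U x -> F x = f x) ->
  curve_at M p v c -> is_derive (0 : R) 1 (f \o c) ('D_v F p).
Proof.
move=> oU Up CF Ff [c0 Mc _ cv].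
have dc : differentiable c (0 : R) by apply/derivable1_diffP; exact: ex_derive.
have dF : differentiable F (c 0) by rewrite c0; exact: (CF 1%N).1.
have dFc := differentiable_comp dc dF.
have Uc : \forall t \near (0 : R), U (c t).
  by apply: (differentiable_continuous dc); rewrite c0; exact: open_nbhs_nbhs.
apply: (@near_eq_is_derive _ _ _ (F \o c)).
  by near=> t => /=; apply: Ff; near: t.
apply: DeriveDef; first exact: diff_derivable.
rewrite (deriveE _ dFc) (diff_comp dc dF) /= -(deriveE (1 : R) dc) derive_val.
by rewrite -c0 (deriveE _ dF).
Unshelve. all: by end_near.
Qed.

(** A row [c] killed by the matrix gives a combination [w] of the [n_i] with ['[w, G n_j] = 0] for
    all [j], hence ['[w, G w] = 0]. Positivity forces [w = 0], and freeness forces [c = 0]. *)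
Lemma gram_unitmx k (G : 'End(E)) (n : k.-tuple E) :
  free n -> (forall v, v != 0 -> 0 < '[v, G v]) ->
  \matrix_(i, j) '[tnth n i, G (tnth n j)] \in unitmx.
Proof.
move=> /freeP fn Gpos; rewrite -row_free_unit -kermx_eq0; apply/rowV0P => c.
move/sub_kermxP => cA.
pose w := \sum_i c 0 i *: n`_i.
have wG (j : 'I_k) : '[w, G n`_j] = 0.
  have /rowP/(_ j) := cA; rewrite !mxE => <-.
  rewrite inner_suml; apply: eq_bigr => i _.
  by rewrite mxE innerZl !(tnth_nth 0).
have w0 : w = 0.
  apply/eqP; apply: contraT => /Gpos; suff -> : '[w, G w] = 0 by rewrite ltxx.
  rewrite {2}/w linear_sum innerC inner_suml big1 // => j _.
  by rewrite linearZ innerZl innerC wG mulr0.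
by apply/rowP => i; rewrite mxE; exact: fn w0 i.
Qed.

Lemma smooth_at_frame k M H g (p : E) U (n : 'I_k -> E -> E) X :
  metric_operator M g -> M p -> open U -> U p ->
  (forall i, smooth_on (M `&` U) (n i)) ->
  (forall q, M q -> U q -> basis_of (H q) [tuple n i q | i < k]) ->
  (forall q, M q -> X q \in H q) ->
  (forall i, smooth_at (M `&` U) p (fun q => '[X q, g q (n i q)])) ->
  smooth_at M p X.
Proof.
move=> [gS gP] Mp oU Up nS nB XH XS; apply: (smooth_at_setI oU Up).
have {}nS i : smooth_at (M `&` U) p (n i) by exact: nS.
pose A q : 'M[R]_k := \matrix_(i, j) '[n i q, g q (n j q)].
pose b q : 'rV[R]_k := \row_i '[X q, g q (n i q)].
have uA q : (M `&` U) q -> A q \in unitmx.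
  move=> [Mq Uq]; have := gram_unitmx (basis_free (nB q Mq Uq)) (gP q Mq).2.
  by congr (_ \in unitmx); apply/matrixP => i j; rewrite !mxE !tnth_mktuple.
have AS i j : smooth_at (M `&` U) p (fun q => A q i j).
  apply: (@eq_smooth_at _ _ _ _ _ (fun q => '[n i q, g q (n j q)])); last first.
    by move=> q; rewrite mxE.
  apply: smooth_at_inner => //; apply: smooth_at_lfun => // v.
  by apply: smooth_at_sub (gS v p Mp); exact: subIsetl.
apply: (@smooth_at_eq _ _ _ _ _ setT
  (fun q => \sum_j (\sum_i b q 0 i * invmx (A q) i j) *: n j q)).
- exact: openT.
- by [].
- move=> q MUq _; have [Mq Uq] := MUq.
  have := coord_basis (nB q Mq Uq) (XH q Mq).
  set a := coord _ => XE.
  (* Pairing the frame expansion of [X q] with each [g q (n i q)] gives a linear system for the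
     coordinates, solved by inverting the Gram matrix [A q]. *)
  have bE : b q = (\row_j a j (X q)) *m A q.
    apply/rowP => i; rewrite !mxE {1}XE inner_suml; apply: eq_bigr => j _.
    by rewrite !mxE innerZl -tnth_nth tnth_mktuple.
  rewrite [RHS]XE; apply: eq_bigr => j _.
  rewrite -tnth_nth tnth_mktuple; congr (_ *: _).
  have /rowP/(_ j) : b q *m invmx (A q) = \row_j a j (X q).
    by rewrite bE mulmxK // uA.
  by rewrite !mxE.
apply: smooth_at_sum => j _; apply: smooth_atZ => //.
apply: smooth_at_sum => i _; apply: smooth_atM; last exact: smooth_at_invmx.
by apply: eq_smooth_at (XS i) _ => q; rewrite mxE.
Qed.

(** Hides the frame: testing against every local smooth section [Y] of [H] covers the frame fields
    in particular. *)
Lemma smooth_on_frame k M H g X :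
  metric_operator M g -> subbundle k M H -> (forall q, M q -> X q \in H q) ->
  (forall (Y : E -> E) U p, M p -> U p -> open U ->
     (forall q, M q -> U q -> Y q \in H q) -> smooth_at (M `&` U) p Y ->
     smooth_at (M `&` U) p (fun q => '[X q, g q (Y q)])) ->
  smooth_on M X.
Proof.
move=> gM [_ Hfr] XH XS p Mp; have [U [n [oU Up nS nB]]] := Hfr p Mp.
apply: (smooth_at_frame gM Mp oU Up nS nB XH) => i.
apply: XS => //; last exact: nS.
move=> q Mq Uq; apply: (basis_mem (nB q Mq Uq)).
by rewrite -(tnth_mktuple (fun i => n i q)) mem_tnth.
Qed.

(** * The projection, and the gradient obtained from it *)

Section Projection.
Context (k : nat) (M : set E) (H : E -> {vspace E}) (g Pi : E -> 'End(E)).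
Hypotheses (gM : metric_operator M g) (HM : subbundle k M H).
Hypothesis PiP : forall Y, M Y -> is_gprojection (g Y) (H Y) (Pi Y).

Lemma subbundle_field_smooth X : smooth_on M X ->
  (forall q, M q -> X q \in H q) -> subbundle_field M H X.
Proof.
by move=> XS XH; split=> //; split=> // q Mq; apply: HM.1 => //; exact: XH.
Qed.

Lemma gprojection_field v : subbundle_field M H (fun Y => Pi Y v).
Proof.
have PH q : M q -> Pi q v \in H q by move=> Mq; exact: (PiP Mq).1.
apply: subbundle_field_smooth => //.
apply: (smooth_on_frame gM HM) => // Y U p Mp Up oU YH YS.
(* Against a section of [H] the defining identity of the projection removes [Pi], leaving an
   expression known to be smooth. *)
apply: (@smooth_at_eq _ _ _ _ _ setT (fun q => '[v, g q (Y q)])) => //.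
- exact: openT.
- by move=> q [Mq Uq] _; rewrite (PiP Mq).2 // YH.
apply: smooth_at_inner; first exact: smooth_at_cst.
apply: smooth_at_lfun => // w.
by apply: smooth_at_sub (gM.1 w p Mp); exact: subIsetl.
Qed.

(** The difference [Pi Y e - u] lies in [H Y] and is orthogonal to [H Y] for the metric, hence to
    itself, so it vanishes by positivity. *)
Lemma eq_gprojection Y e u : M Y -> u \in H Y ->
  (forall w, w \in H Y -> '[u, g Y w] = '[e, g Y w]) -> Pi Y e = u.
Proof.
move=> MY uH uE; have [PH PE] := PiP MY.
apply/eqP; rewrite -subr_eq0; apply: contraT => /((gM.2 Y MY).2).
have dH : Pi Y e - u \in H Y by rewrite rpredB.
by rewrite innerBl PE // uE // subrr ltxx.
Qed.

Lemma gprojection_id Y w : M Y -> w \in H Y -> Pi Y w = w.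
Proof. by move=> MY wH; exact: eq_gprojection. Qed.

Lemma metric_operator_ker Y : M Y -> lker (g Y) = 0%VS.
Proof.
move=> MY; apply/eqP; rewrite -subv0; apply/subvP => v.
rewrite memv_ker memv0 => /eqP gv.
by apply: contraT => /((gM.2 Y MY).2); rewrite gv innerC linear0l ltxx.
Qed.

Lemma metric_operator_invK Y v : M Y -> g Y ((g Y)^-1%VF v) = v.
Proof.
move=> MY; have /eqP k0 := metric_operator_ker MY.
by rewrite lker0_lfunVK.
Qed.

Lemma metric_operator_sym Y u v : M Y -> '[u, g Y v] = '[g Y u, v].
Proof. by move=> MY; rewrite adjointP (gM.2 Y MY).1. Qed.

Context (f : E -> R) (gradf : E -> E).
Hypotheses (fS : smooth_on M f) (fG : ambient_gradient M f gradf).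

Let X Y := Pi Y ((g Y)^-1%VF (gradf Y)).

Lemma rgradient_inner Y w : M Y -> w \in H Y -> '[X Y, g Y w] = '[w, gradf Y].
Proof.
move=> MY wH; rewrite (PiP MY).2 // metric_operator_sym //.
by rewrite metric_operator_invK // innerC.
Qed.

(** Both sides are the derivative of [f] along one curve through [q] with velocity [v]: the left by
    testing the ambient gradient on the field [Pi _ v], whose value at [q] is [v], the right by the
    chain rule. *)
Lemma ambient_gradient_derive U (F : E -> R) q v : M q -> v \in H q ->
  open U -> U q -> smooth_open U F -> (forall x, M x -> U x -> F x = f x) ->
  '[v, gradf q] = 'D_v F q.
Proof.
move=> Mq vH oU Uq CF Ff.
have [c cv] := HM.1 q Mq v vH.
have := fG (gprojection_field v).1 Mq.
rewrite gprojection_id // => /(_ c cv) d1.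
have d2 := curve_derive oU Uq CF Ff cv.
by rewrite -(derive_val (is_derive := d1)) (derive_val (is_derive := d2)).
Qed.

Lemma rgradient_smooth : smooth_on M X.
Proof.
apply: (smooth_on_frame gM HM); first by move=> q Mq; exact: (PiP Mq).1.
move=> Y U p Mp Up oU YH YS.
have [U' [F [oU' U'p CF Ff]]] := fS Mp.
(* Nothing is assumed on the smoothness of [gradf], so its pairing with [Y] is replaced by a
   derivative of the smooth extension [F]. *)
apply: (@smooth_at_eq _ _ _ _ _ U' (fun q => 'D_(Y q) F q)) => //.
- move=> q [Mq Uq] U'q.
  rewrite rgradient_inner ?YH //.
  by rewrite (ambient_gradient_derive _ _ oU' U'q CF Ff) ?YH.
apply: (smooth_at_apply (h := fun x v => 'D_v F x)) => //.
  exists U'; split=> // x _ U'x a v w.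
  by have dF := (CF 1%N).1 x U'x; rewrite !deriveE // linearP.
(* One order is lost: ['D_v F] is of class [j] because [F] is of class [j.+1]. *)
move=> v; exists U', (fun x => 'D_v F x); split=> // j.
exact: (CF j.+1).2.
Qed.

Lemma ambient_gradient_rgradient : is_rgradient M g H f X.
Proof.
have Xrep : represents_differential M g H f X.
  move=> xi xiH Y MY; rewrite /rmetric rgradient_inner //; last exact: xiH.2.
  exact: (fG xiH.1 MY).
split=> //.
  apply: subbundle_field_smooth => [|q Mq].
    exact: rgradient_smooth.
  exact: (PiP Mq).1.
(* For uniqueness, each [w] in [H Y] is extended to the field [Pi _ w]. Along a curve with velocity
   [w], the derivative of [f] is the metric pairing of [w] with either candidate, so the two
   pairings coincide. *)
move=> X' [X'V X'H] X'rep Y MY; apply/esym.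
apply: eq_gprojection => // [|w wH]; first exact: X'H.
have [c cw] := HM.1 Y MY w wH.
have := Xrep _ (gprojection_field w) Y MY.
have := X'rep _ (gprojection_field w) Y MY.
rewrite gprojection_id // => /(_ c cw) d1 /(_ c cw) d2.
rewrite -[LHS](derive_val (is_derive := d1)) (derive_val (is_derive := d2)).
exact: (PiP MY).2.
Qed.

End Projection.
End GradientSmoothness.

(** [^-1%VF] is defined for every linear map; the trivial kernels asserted with the two formulas
    make it the genuine inverse of [S] and of [T]. *)
Theorem proposition2 (R : realType) (E : innerProductType R) (d k : nat)
    (M : set E) (g : E -> 'End(E)) (H : E -> {vspace E}) (Pi : E -> 'End(E)) :
  embedded_submanifold d M ->
  metric_operator M g ->
  subbundle k M H ->
  (forall Y, M Y -> is_gprojection (g Y) (H Y) (Pi Y)) ->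
  [/\ forall (f : E -> R) (gradf : E -> E),
        smooth_on M f -> ambient_gradient M f gradf ->
        is_rgradient M g H f (fun Y => Pi Y ((g Y)^-1%VF (gradf Y))),
      forall (EJ : innerProductType R) (J : E -> 'Hom(E, EJ)),
        (forall Y, M Y -> limg (J Y) = fullv /\ lker (J Y) = H Y) ->
        forall Y, M Y ->
          let gi := (g Y)^-1%VF in
          let Jt := adjoint (J Y) in
          let S := (J Y \o gi \o Jt)%VF in
          lker S = 0%VS /\
          forall e, Pi Y e = e - gi (Jt (S^-1%VF (J Y e))) &
      forall (EN : innerProductType R) (N : E -> 'Hom(EN, E)),
        (forall Y, M Y -> lker (N Y) = 0%VS /\ limg (N Y) = H Y) ->
        forall Y, M Y ->
          let Nt := adjoint (N Y) in
          let T := (Nt \o g Y \o N Y)%VF in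
          lker T = 0%VS /\
          forall e, Pi Y e = N Y (T^-1%VF (Nt (g Y e)))].
Proof.
move=> _ gM HM PiP; split.
- by move=> f gradf; exact: ambient_gradient_rgradient gM HM PiP f gradf.
- move=> EJ J JP Y MY gi Jt S; have [Jfull JH] := JP Y MY.
  have gK v : g Y (gi v) = v by apply: (metric_operator_invK gM).
  (* If [S y = 0], then [gi (Jt y)] has metric square ['[gi (Jt y), Jt y] = '[S y, y] = 0], so
     [Jt y = 0]. Writing [y = J Y x] by surjectivity gives ['[y, y] = '[x, Jt y] = 0]. *)
  have S0 : lker S = 0%VS.
    apply/eqP; rewrite -subv0; apply/subvP => y.
    rewrite memv_ker memv0 => /eqP Sy.
    have Jty : gi (Jt y) = 0.
      apply/eqP; apply: contraT => /((gM.2 Y MY).2).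
      by rewrite gK -adjointP -!comp_lfunE Sy linear0l ltxx.
    have {}Jty : Jt y = 0 by rewrite -[Jt y]gK Jty linear0.
    have /memv_imgP[x _ yE] : y \in limg (J Y) by rewrite Jfull memvf.
    apply: contraT => /inner_gt0.
    by rewrite {1}yE adjointP -/Jt Jty innerC linear0l ltxx.
  split=> // e; apply: (eq_gprojection gM PiP) => //.
    (* Applying [J Y] to the correction term gives [S (S^-1 (J Y e)) = J Y e], so the candidate lies
       in the kernel of [J Y]. *)
    rewrite -JH memv_ker linearB /= subr_eq0.
    have /eqP kS := S0.
    have := lker0_lfunVK kS (J Y e); rewrite !comp_lfunE => ->.
    by [].
  (* The correction term pairs to zero with [g Y w]: [g Y] cancels [gi], and [Jt] moves across as
     [J Y], which kills [w]. *)
  move=> w; rewrite -JH memv_ker => /eqP Jw.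
  rewrite innerBl -[RHS]subr0; congr (_ - _).
  by rewrite (metric_operator_sym gM) // gK innerC -adjointP Jw linear0l.
- move=> EN N NP Y MY Nt T; have [N0 NH] := NP Y MY.
  (* If [T y = 0], then ['[N Y y, g Y (N Y y)] = '[y, T y] = 0], so [N Y y = 0] and injectivity
     gives [y = 0]. *)
  have T0 : lker T = 0%VS.
    apply/eqP; rewrite -subv0; apply/subvP => y.
    rewrite memv_ker memv0 => /eqP Ty.
    have Ny : N Y y = 0.
      apply/eqP; apply: contraT => /((gM.2 Y MY).2).
      by rewrite adjointP -!comp_lfunE Ty innerC linear0l ltxx.
    by rewrite -memv0 -N0 memv_ker Ny.
  split=> // e; apply: (eq_gprojection gM PiP) => //.
    by rewrite -NH memv_img ?memvf.
  (* With [w = N Y y], moving [N Y] across the pairing produces [T (T^-1 (Nt (g Y e)))], which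
     collapses to [Nt (g Y e)]. *)
  move=> w; rewrite -NH => /memv_imgP[y _ ->].
  rewrite (metric_operator_sym gM) // innerC adjointP -/Nt.
  have /eqP kT := T0.
  have := lker0_lfunVK kT (Nt (g Y e)); rewrite !comp_lfunE => ->.
  by rewrite -adjointP innerC (metric_operator_sym gM).
Qed.
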